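(* Let $q$ be a prime power and let $r,n,h$ be positive integers such that $(h+1)$ divides $rn$, $n\geq h+3$, and $(n,h)\ne(4,1)$. Let $V$ be an $r$-dimensional $\mathbb{F}_{q^n}$-vector space, $U$ an $\mathbb{F}_q$-subspace of $V$ with $\dim_{\mathbb{F}_q}U=\frac{hrn}{h+1}\le (r-1)n$ and $\max\{\dim_{\mathbb{F}_q}(U\cap\langle\mathbf v\rangle_{\mathbb{F}_{q^n}}):\mathbf v\in V\setminus\{\mathbf 0\}\}=h$, let $W$ be an $\frac{rn}{h+1}$-dimensional $\mathbb{F}_q$-vector space, and $G:V\to W$ an $\mathbb{F}_q$-linear map with $\ker G=U$. Let $\mathcal{C}=\mathcal{C}_{U,G}$ be the corresponding MRD code, with parameters $\left(\frac{rn}{h+1},n,q;n-h\right)$. If $(h+1)$ does not divide $r$, then $\mathcal{C}$ is not equivalent to any punctured generalized Gabidulin code nor to any punctured generalized twisted Gabidulin code.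
   Context: **Rank metric codes.** An $\mathbb{F}_q$-linear rank metric code with parameters $(m,n,q;d)$ is an $\mathbb{F}_q$-subspace of $\mathbb{F}_q^{m\times n}$ (equivalently, after fixing bases, of $\mathrm{Hom}_{\mathbb{F}_q}(W_1,W_2)$ with $\dim W_1=n$, $\dim W_2=m$) whose minimum nonzero rank is $d$. It is MRD if its size is $q^{\max\{m,n\}(\min\{m,n\}-d+1)}$. Codes $\mathcal{C},\mathcal{C}'\subseteq\mathbb{F}_q^{m\times n}$ are equivalent if $\mathcal{C}'=\{XC^\sigma Y+Z:C\in\mathcal{C}\}$ for some $X\in\mathrm{GL}(m,q)$, $Y\in\mathrm{GL}(n,q)$, $Z\in\mathbb{F}_q^{m\times n}$, $\sigma\in\mathrm{Aut}(\mathbb{F}_q)$. The adjoint code is $\mathcal{C}^\top=\{C^t:C\in\mathcal{C}\}$. **Codes $\mathcal{C}_{U,G}$.** $\mathcal{C}_{U,G}=\{\Gamma_{\mathbf v}:\mathbf v\in V\}\subseteq\mathrm{Hom}_{\mathbb{F}_q}(\mathbb{F}_{q^n},W)$, where $\Gamma_{\mathbf v}(\lambda)=G(\lambda\mathbf v)$ for $\lambda\in\mathbb{F}_{q^n}$. **Generalized (twisted) Gabidulin codes.** Let $N,k,s$ be positive integers with $k<N$ and $\gcd(s,N)=1$. The generalized Gabidulin code $\mathcal{G}_{k,s}$ is the set of maps $\mathbb{F}_{q^N}\to\mathbb{F}_{q^N}$, $x\mapsto a_0x+a_1x^{q^s}+\cdots+a_{k-1}x^{q^{s(k-1)}}$,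 with $a_0,\dots,a_{k-1}\in\mathbb{F}_{q^N}$. For $0\le c<N$ and $\eta\in\mathbb{F}_{q^N}$ with $\eta^{(q^N-1)/(q-1)}\ne(-1)^{Nk}$, the generalized twisted Gabidulin code $\mathcal{H}_{k,s}(\eta,c)$ is the set of maps $\mathbb{F}_{q^N}\to\mathbb{F}_{q^N}$, $x\mapsto a_0x+a_1x^{q^s}+\cdots+a_{k-1}x^{q^{s(k-1)}}+a_0^{q^c}\eta x^{q^{sk}}$, with $a_i\in\mathbb{F}_{q^N}$. Both are MRD codes with parameters $(N,N,q;N-k+1)$. **Punctured codes and the convention on inequivalence.** A punctured generalized (twisted) Gabidulin code is $\mathcal{D}=g\circ\mathcal{G}_{k,s}$ (respectively $\mathcal{D}=g\circ\mathcal{H}_{k,s}(\eta,c)$), where $g:\mathbb{F}_{q^N}\to\mathbb{F}_{q^M}$ is an $\mathbb{F}_q$-linear map of rank $M\le N$; its matrices are $M\times N$. Since $\mathcal{C}$ consists of $\frac{rn}{h+1}\times n$ matrices with $\frac{rn}{h+1}\ge n$, ''$\mathcal{C}$ is not equivalent to a punctured generalized (twisted) Gabidulin code'' means that $\mathcal{C}$ is not equivalent to the adjoint $\mathcal{D}^\top$ of any such $\mathcal{D}$. *)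

(* Defs.v *)
From HB Require Import structures.
From mathcomp Require Import all_boot all_order all_algebra all_field.
From mathcomp Require Import classical_sets.

Set Implicit Arguments.
Unset Strict Implicit.
Unset Printing Implicit Defensive.

Import GRing.Theory.
Local Open Scope ring_scope.
Local Open Scope classical_set_scope.

(* Restriction of scalars: [restrict V] is the L-vector space V regarded as a
   vector space over F.  This is the analogue, for a vector space, of
   [baseFieldType]; the latter only applies to field extensions. *)
Section Restrict.

Variables (F : fieldType) (L : fieldExtType F) (V : vectType L).

Definition restrict : Type := V.

HB.instance Definition _ := GRing.Zmodule.on restrict.

Definition restrict_scale (a : F) (v : restrict) : restrict :=
  (in_alg L a : L) *: (v : V).

Fact restrict_scaleA a b v :
  restrict_scale a (restrict_scale b v) = restrict_scale (a * b) v.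
Proof. by rewrite /restrict_scale scalerA -rmorphM. Qed.

Fact restrict_scale1 : left_id 1 restrict_scale.
Proof. by move=> v; rewrite /restrict_scale rmorph1 scale1r. Qed.

Fact restrict_scaleDr : right_distributive restrict_scale +%R.
Proof. by move=> a u v; exact: scalerDr. Qed.

Fact restrict_scaleDl v : {morph restrict_scale^~ v : a b / a + b}.
Proof. by move=> a b; rewrite /restrict_scale rmorphD scalerDl. Qed.

HB.instance Definition _ := GRing.Zmodule_isLmodule.Build F restrict
  restrict_scaleA restrict_scale1 restrict_scaleDr restrict_scaleDl.

Lemma restrict_scaleE a (v : V) : a *: (v : restrict) = (a%:A : L) *: v.
Proof. by []. Qed.

Lemma restrict_scaleZ a (x : L) (v : V) :
  a *: ((x *: v : V) : restrict) = (a *: x) *: v.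
Proof. by rewrite restrict_scaleE scalerA -scalerAl mul1r. Qed.

Let n := \dim {:L}.
Let bL : n.-tuple L := vbasis {:L}.
Let coordL (x : L) := coord_vbasis (memvf x).

Fact restrict_vectMixin : Lmodule_hasFinDim F restrict.
Proof.
pose bV := vbasis {:V}; set m := \dim {:V} in bV.
pose v2r (x : restrict) := mxvec (\matrix_(i, j) coord bL j (coord bV i (x : V))).
have v2r_lin: linear v2r.
  move=> a x y; rewrite -linearP; congr mxvec; apply/matrixP=> i j.
  by rewrite !mxE linearP /= mulr_algl linearP.
pose r2v r : restrict :=
  \sum_(i < m) (\sum_(j < n) vec_mx r i j *: bL`_j) *: bV`_i.
have v2rK: cancel v2r r2v.
  move=> x; transitivity (\sum_(i < m) coord bV i (x : V) *: bV`_i); last first.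
    by rewrite -coord_vbasis ?memvf.
  apply: eq_bigr => i _; rewrite mxvecK; congr (_ *: _ : V).
  by rewrite (coordL (coord bV i x)); apply: eq_bigr => j _; rewrite mxE.
exists (m * n)%N, v2r => //; exists r2v => // r.
apply: (canLR vec_mxK); apply/matrixP=> i j; rewrite mxE.
by rewrite !coord_sum_free ?(basis_free (vbasisP _)).
Qed.

HB.instance Definition _ := restrict_vectMixin.

Let restrict_basis (S : {vspace V}) : seq restrict :=
  [seq (tnth bL ij.2 *: tnth (vbasis S) ij.1 : V)
     | ij : 'I_(\dim S) * 'I_n].

(* The F-subspace with the same elements as the L-subspace S. *)
Definition restrict_vspace (S : {vspace V}) : {vspace restrict} :=
  <<restrict_basis S>>%VS.

Lemma mem_restrict_vspace (S : {vspace V}) : restrict_vspace S =i S.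
Proof.
move=> y; apply/idP/idP=> [/coord_span->|/coord_vbasis->]; last first.
  apply: memv_suml => i _; rewrite (coordL (coord _ i (y : V))) scaler_suml -/n.
  apply: memv_suml => j _; rewrite -/bL -restrict_scaleZ memvZ ?memv_span //.
  by rewrite -!tnth_nth; apply/fintype.imageP; exists (i, j).
apply: memv_suml => k _; rewrite nth_image; case: (enum_val k) => i j /=.
by rewrite restrict_scaleZ memvZ ?vbasis_mem ?mem_tnth.
Qed.

Lemma dim_restrict_vspace (S : {vspace V}) :
  \dim (restrict_vspace S) = (\dim S * \dim {:L})%N.
Proof.
pose bV0 := restrict_basis S; set m := \dim S in bV0 *.
suffices /size_basis->: basis_of (restrict_vspace S) bV0.
  by rewrite card_prod !card_ord.
rewrite /basis_of eqxx.
apply/freeP=> s sb0 k; rewrite -(enum_valK k); case/enum_val: k => i j.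
have free_baseP := freeP (basis_free (vbasisP _)).
move: j; apply: (free_baseP _ _ fullv); move: i; apply: (free_baseP _ _ S).
transitivity (\sum_i \sum_j s (enum_rank (i, j)) *: bV0`_(enum_rank (i, j))).
  apply: eq_bigr => i _; rewrite scaler_suml; apply: eq_bigr => j _.
  by rewrite -restrict_scaleZ nth_image enum_rankK -!tnth_nth.
rewrite pair_bigA (reindex _ (onW_bij _ (enum_val_bij _))); apply: etrans sb0.
by apply: eq_bigr => k _; rewrite -{5 6}[k](enum_valK k); case/enum_val: k.
Qed.

(* The F-dimension of the intersection of U with the L-line spanned by v. *)
Definition line_weight (U : {vspace restrict}) (v : V) : nat :=
  \dim (U :&: restrict_vspace <[v]>)%VS.

(* h is the maximum of the line weights of U over the nonzero vectors. *)
Definition max_line_weight (U : {vspace restrict}) (h : nat) : Prop :=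
  (exists2 v : V, v != 0 & line_weight U v = h) /\
  (forall v : V, v != 0 -> (line_weight U v <= h)%N).

End Restrict.

Section RankMetricCode.

Variable F : finFieldType.

Definition code_equiv (m n : nat) (C C' : set 'M[F]_(m, n)) : Prop :=
  exists (X : 'M[F]_m) (Y : 'M[F]_n) (Z : 'M[F]_(m, n))
         (sigma : {rmorphism F -> F}),
    [/\ X \in unitmx, Y \in unitmx, bijective sigma &
        C' = [set X *m map_mx sigma A *m Y + Z | A in C]].

Definition adjoint_code (m n : nat) (C : set 'M[F]_(m, n)) :
  set 'M[F]_(n, m) := [set A^T | A in C].

(* The matrix acts on column vectors, so a map from a space of dimension n to a
   space of dimension m is an m x n matrix; [mxof] is the transpose of this. *)
Definition hom_mx (m n : nat) (W1 W2 : vectType F)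
    (b1 : n.-tuple W1) (b2 : m.-tuple W2) (f : 'Hom(W1, W2)) : 'M[F]_(m, n) :=
  \matrix_(i < m, j < n) coord b2 i (f (tnth b1 j)).

Definition mx_code (m n : nat) (W1 W2 : vectType F)
    (b1 : n.-tuple W1) (b2 : m.-tuple W2) (C : set 'Hom(W1, W2)) :
  set 'M[F]_(m, n) := [set hom_mx b1 b2 f | f in C].

End RankMetricCode.

Section CodeUG.

Variables (F : fieldType) (L : fieldExtType F) (V : vectType L).
Variables (W : vectType F) (G : 'Hom(restrict V, W)).

Definition Gamma_fun (v : V) (x : L) : W := G (x *: v : V).

Fact Gamma_fun_linear v : linear (Gamma_fun v).
Proof.
move=> a x y; rewrite /Gamma_fun -linearP; congr (G _).
by rewrite scalerDl restrict_scaleZ.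
Qed.

HB.instance Definition _ (v : V) :=
  GRing.isLinear.Build F L W _ (Gamma_fun v) (Gamma_fun_linear v).

Definition Gamma (v : V) : 'Hom(L, W) := linfun (Gamma_fun v).

Lemma GammaE v x : Gamma v x = G (x *: v : V).
Proof. by rewrite lfunE. Qed.

Definition code_UG : set 'Hom(L, W) := [set Gamma v | v in [set: V]].

End CodeUG.

Section Gabidulin.

Variables (F : finFieldType) (K : fieldExtType F).
Local Notation q := #|F|.
Local Notation N := (\dim {:K}).

Lemma frob_linear (j : nat) (b : F) (x y : K) :
  (b *: x + y) ^+ (q ^ j) = b *: x ^+ (q ^ j) + y ^+ (q ^ j).
Proof.
have [p pp pF] := finPcharP F.
have [e qE] : {e | q = (p ^ e)%N}.
  by exists (logn p q); rewrite (card_pprimeChar pF) pfactorK.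
have pK : p \in [pchar K] by rewrite pchar_lalg.
rewrite exprDn_pchar; last first.
  rewrite qE -expnM pnatX; apply/orP; left.
  by rewrite pnatE.
rewrite exprZn; congr (_ *: _ + _).
by elim: j => [|j IH]; rewrite ?expr1 // expnSr exprM IH expf_card.
Qed.

(* x |-> \sum_(i < k) a_i x^(q^(s i)); only the values a 0, ..., a k.-1
   matter. *)
Definition gab_fun (k s : nat) (a : nat -> K) (x : K) : K :=
  \sum_(i < k) a i * x ^+ (q ^ (s * i)).

Definition tgab_fun (k s c : nat) (eta : K) (a : nat -> K) (x : K) : K :=
  gab_fun k s a x + (a 0%N) ^+ (q ^ c) * eta * x ^+ (q ^ (s * k)).

Fact gab_fun_linear k s a : linear (gab_fun k s a).
Proof.
move=> b x y; rewrite /gab_fun scaler_sumr -big_split /=.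
by apply: eq_bigr => i _; rewrite frob_linear mulrDr scalerAr.
Qed.

Fact tgab_fun_linear k s c eta a : linear (tgab_fun k s c eta a).
Proof.
move=> b x y; rewrite /tgab_fun gab_fun_linear frob_linear mulrDr scalerDr.
by rewrite -scalerAr addrACA.
Qed.

HB.instance Definition _ k s a :=
  GRing.isLinear.Build F K K _ (gab_fun k s a) (gab_fun_linear k s a).

HB.instance Definition _ k s c eta a :=
  GRing.isLinear.Build F K K _ (tgab_fun k s c eta a)
    (tgab_fun_linear k s c eta a).

Definition gabidulin_code (k s : nat) : set 'End(K) :=
  [set linfun (gab_fun k s a) | a in [set: nat -> K]].

Definition twisted_gabidulin_code (k s c : nat) (eta : K) : set 'End(K) :=
  [set linfun (tgab_fun k s c eta a) | a in [set: nat -> K]].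

Definition gabidulin_params (k s : nat) : Prop :=
  [/\ (0 < k)%N, (k < N)%N, (0 < s)%N & coprime s N].

Definition twist_params (k c : nat) (eta : K) : Prop :=
  (c < N)%N /\ eta ^+ ((q ^ N - 1) %/ (q - 1)) != (-1) ^+ (N * k).

End Gabidulin.

Section Punctured.

Variables (F : finFieldType) (M N : nat).

(* D is the set of matrices, in some bases, of the maps g \o f for f in the code
   E K, K of degree N over F and g : K -> K' a linear map of rank M = [K' : F]. *)
Definition punctured_of (E : forall K : fieldExtType F, set 'End(K) -> Prop)
    (D : set 'M[F]_(M, N)) : Prop :=
  exists (K K' : fieldExtType F) (b : N.-tuple K) (b' : M.-tuple K')
         (g : 'Hom(K, K')) (C : set 'End(K)),
    [/\ (M <= N)%N, basis_of {:K} b /\ basis_of {:K'} b', \dim (limg g) = M,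
        E K C & D = mx_code b b' [set (g \o f)%VF | f in C]].

Definition is_punctured_gabidulin : set 'M[F]_(M, N) -> Prop :=
  punctured_of (fun K C => exists k s : nat,
    gabidulin_params K k s /\ C = gabidulin_code k s).

Definition is_punctured_twisted_gabidulin : set 'M[F]_(M, N) -> Prop :=
  punctured_of (fun K C => exists (k s c : nat) (eta : K),
    [/\ gabidulin_params K k s, twist_params k c eta &
        C = twisted_gabidulin_code k s c eta]).

End Punctured.

(* Main.v *)
Require Import Defs.
From HB Require Import structures.
From mathcomp Require Import all_boot all_order all_algebra all_field.
From mathcomp Require Import classical_sets.
From mathcomp Require Import zify.

Set Implicit Arguments.
Unset Strict Implicit.
Unset Printing Implicit Defensive.

Import GRing.Theory.
Local Open Scope ring_scope.

(** The obstruction is an idealiser. Put N = rn/(h+1). Multiplication by an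
    element x of L sends Gamma v to Gamma (x v), so the matrices of these
    multiplications form a field of order q^n acting on the code of G from the
    right. An equivalence with the adjoint of a punctured code carries this
    field to a field of order q^n acting from the left on g o H, where g maps
    the field K of degree N onto a space of dimension n and H is the
    generalized twisted Gabidulin code; the untwisted code is the case eta = 0.

    The left idealiser of g o H, however, embeds in K, each of its elements phi
    satisfying phi (g x) = g (b x) for some b in K
    ([twisted_left_idealiser]). So L embeds in K, hence n divides
    N = rn/(h+1), which says that h+1 divides r
    ([embedding_dim_dvd], [punctured_twisted_equiv_dvd]).

    The idealiser is computed by comparing coefficients. Write sigma for
    x |-> x^(q^s), a generator of the Galois group of K over F as s is coprime
    to N. A sigma-polynomial with n consecutive coefficients has fewer than q^n
    roots, unless it is zero ([qeval_vanish]), while g has a kernel of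
    dimension N - n; therefore g o f determines f whenever f has sigma-degree
    less than n ([qeval_puncture_eq]). Applied to the images under phi of the
    monomials x^(sigma^i), with 0 < i < k, this forces phi (g x) to be
    g (u x^(sigma^-1) + v x + w x^sigma), and the codeword x + eta x^(sigma^k)
    then forces u = w = 0. The same injectivity, with a count of codewords,
    gives k = h+1 ([punctured_twisted_dim]), so the comparison only involves
    sigma-degrees below h+3 <= n, or below 5 when h = 1; this is where
    (n, h) = (4, 1) has to be left out. *)

(** * Sigma-polynomials over a finite field extension *)

Section LinearizedPolynomials.

Variables (F : finFieldType) (K : fieldExtType F) (s : nat).
Local Notation q := #|F|.
Local Notation N := (\dim {:K}).

(** A polynomial is read as the list of coefficients of a sigma-polynomial.
    Multiplying by ['X] on the right then precomposes with sigma
    ([qeval_mulX]), so that a right factor ['X - 1] stands for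
    x^sigma - x. *)
Definition qeval (p : {poly K}) (x : K) : K := gab_fun (size p) s (nth 0 p) x.

Lemma qevalE n (p : {poly K}) x :
  (size p <= n)%N -> qeval p x = gab_fun n s (nth 0 p) x.
Proof.
move=> le_pn; rewrite /qeval /gab_fun.
rewrite (big_ord_widen n (fun i => p`_i * x ^+ (q ^ (s * i)))) // big_mkcond.
by apply: eq_bigr => i _; case: ltnP => // le_i; rewrite nth_default ?mul0r.
Qed.

Lemma qeval_poly n a x : qeval (\poly_(i < n) a i) x = gab_fun n s a x.
Proof.
rewrite (qevalE _ (size_poly n a)).
by apply: eq_bigr => i _; rewrite coef_poly ltn_ord.
Qed.

Lemma qevalD p r x : qeval (p + r) x = qeval p x + qeval r x.
Proof.
set n := maxn (size p) (size r).
rewrite !(@qevalE n) ?leq_maxl ?leq_maxr ?size_polyD // -big_split /=.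
by apply: eq_bigr => i _; rewrite coefD mulrDl.
Qed.

Lemma qevalZ c p x : qeval (c *: p) x = c * qeval p x.
Proof.
rewrite (@qevalE (size p)) ?size_scale_leq // /qeval /gab_fun mulr_sumr.
by apply: eq_bigr => i _; rewrite coefZ mulrA.
Qed.

Lemma qevalN p x : qeval (- p) x = - qeval p x.
Proof. by rewrite -scaleN1r qevalZ mulN1r. Qed.

Lemma qevalB p r x : qeval (p - r) x = qeval p x - qeval r x.
Proof. by rewrite qevalD qevalN. Qed.

Lemma qeval_mulX p x : qeval (p * 'X) x = qeval p (x ^+ (q ^ s)).
Proof.
rewrite (@qevalE (size p).+1); last first.
  by rewrite (leq_trans (size_polyMleq _ _)) // size_polyX addn2.
rewrite /gab_fun big_ord_recl coefMX mul0r add0r.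
apply: eq_bigr => i _.
by rewrite coefMX lift0 /= -exprM -expnD -mulnS.
Qed.

Lemma qeval_Xn i x : qeval 'X^i x = x ^+ (q ^ (s * i)).
Proof.
elim: i x => [|i IHi] x; last first.
  by rewrite exprSr qeval_mulX IHi -exprM -expnD mulnS.
by rewrite (@qevalE 1) ?size_polyXn // /gab_fun big_ord1 coef1 mul1r.
Qed.

Lemma qeval1 x : qeval 1 x = x.
Proof. by rewrite -(expr0 'X) qeval_Xn muln0 expr1. Qed.

Lemma qevalZXn c i x : qeval (c *: 'X^i) x = c * x ^+ (q ^ (s * i)).
Proof. by rewrite qevalZ qeval_Xn. Qed.

Lemma qeval_linear p : linear (qeval p).
Proof. exact: gab_fun_linear. Qed.

HB.instance Definition _ p :=
  GRing.isLinear.Build F K K _ (qeval p) (qeval_linear p).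

Lemma frob0 j : 0 ^+ (q ^ j) = 0 :> K.
Proof. by rewrite expr0n expn_eq0 -leqn0 leqNgt ltnW ?finNzRing_gt1. Qed.

Lemma frob_dim (x : K) j : x ^+ (q ^ (N * j)) = x.
Proof.
elim: j => [|j IHj]; first by rewrite muln0 expr1.
rewrite mulnS expnD exprM.
by have /eqP-> : x ^+ (q ^ N) == x by rewrite -Fermat's_little_theorem memvf.
Qed.

(** Modulo N, s is invertible; so a fixed point of x^(q^s) is one of x^q. *)
Lemma frob_fixed (x : K) : coprime s N -> x ^+ (q ^ s) = x -> x \in 1%VS.
Proof.
move=> co_sN fix_x.
rewrite -[1%VS]/(1%AS : {vspace K}) Fermat's_little_theorem dimv1 expn1.
have N_gt0 : (0 < N)%N by rewrite adim_gt0.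
have fix_xj j : x ^+ (q ^ (s * j)) = x.
  elim: j => [|j IHj]; first by rewrite muln0 expr1.
  by rewrite mulnS expnD exprM fix_x.
have [s0|s_gt0] := posnP s.
  move: co_sN; rewrite s0 /coprime gcd0n => /eqP N1.
  by rewrite -[in X in _ == X](frob_dim x 1) N1.
have [a b] := egcdnP N s_gt0; rewrite (eqP co_sN) => Dab _.
have := fix_xj a; rewrite mulnC Dab addnC expnD expn1 exprM [(b * N)%N]mulnC.
by rewrite frob_dim => ->.
Qed.

Lemma frob_surj (y : K) j : exists x, x ^+ (q ^ j) = y.
Proof.
exists (y ^+ (q ^ (j * N - j))); rewrite -exprM -expnD subnK.
  by rewrite mulnC frob_dim.
by rewrite leq_pmulr ?adim_gt0.
Qed.

(** A sigma-polynomial has no more roots than its degree allows: if u is a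
    root, then 1 is a root of p(u x), which therefore factors on the right
    through x^sigma - x, whose kernel is the line F; the cofactor has one
    coefficient less and vanishes on a space of dimension at least
    [\dim S - 1]. *)
Lemma qeval_vanish (p : {poly K}) (S : {vspace K}) :
    coprime s N -> (size p <= \dim S)%N -> {in S, forall x, qeval p x = 0} ->
  p = 0.
Proof.
move=> co_sN; have [n le_pn] := ubnP (size p).
elim: n p S le_pn => // n IHn p S; rewrite ltnS => le_pn le_pS pS0.
have [-> //|nz_p] := eqVneq p 0.
pose u := vpick S; have Su : u \in S := memv_pick S.
have nz_u : u != 0.
  rewrite vpick0 -dimv_eq0 -lt0n (leq_trans _ le_pS) // lt0n.
  by rewrite size_poly_eq0.
pose pu := \poly_(i < size p) (p`_i * u ^+ (q ^ (s * i))).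
have qeval_pu x : qeval pu x = qeval p (u * x).
  rewrite qeval_poly /qeval /gab_fun.
  by apply: eq_bigr => i _; rewrite exprMn mulrA.
have pu_coef i : pu`_i = p`_i * u ^+ (q ^ (s * i)).
  by rewrite coef_poly; case: ltnP => // le_i; rewrite nth_default ?mul0r.
have szpu : (size pu <= size p)%N by apply: size_poly.
(* The sigma-polynomial and the ordinary polynomial agree at 1. *)
have /factor_theorem[r Dpu] : root pu 1.
  apply/rootP; rewrite horner_coef.
  transitivity (qeval pu 1); last by rewrite qeval_pu mulr1 pS0.
  by apply: eq_bigr => i _; rewrite !expr1n.
have pu0 : pu != 0.
  apply: contra nz_p => /eqP pu0; apply/eqP/polyP=> i.
  have /eqP := pu_coef i; rewrite pu0 !coef0 eq_sym mulf_eq0.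
  by rewrite expf_eq0 (negPf nz_u) andbF orbF => /eqP.
have nz_r : r != 0.
  by apply: contraNneq pu0 => r0; rewrite Dpu r0 mul0r.
have szr : (size r).+1 = size pu.
  by rewrite Dpu size_Mmonic ?monicXsubC // size_XsubC addn2.
pose d := linfun (qeval ('X - 1%:P)).
have dE x : d x = x ^+ (q ^ s) - x.
  by rewrite lfunE /= qevalB -['X]mul1r qeval_mulX polyC1 !qeval1.
pose m := amull u^-1; pose S1 := (m @: S)%VS.
case/eqP: nz_r; apply: (IHn r (d @: S1)%VS).
- by rewrite szr (leq_trans szpu).
- have dimS1 : \dim S1 = \dim S.
    apply: limg_dim_eq; apply/eqP; rewrite -subv0; apply/subvP=> x.
    rewrite memv_cap memv_ker lfunE /= mulf_eq0 invr_eq0 (negPf nz_u) /=.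
    by rewrite memv0 => /andP[].
  rewrite -ltnS szr (leq_trans szpu) // (leq_trans le_pS) // -dimS1.
  rewrite -(limg_ker_dim d S1) -add1n leq_add2r.
  apply: leq_trans (dimvS _) (eq_leq (dimv1 K)).
  apply/subvP=> x; rewrite memv_cap memv_ker dE subr_eq0 => /andP[_ /eqP].
  exact: frob_fixed.
move=> _ /memv_imgP[_ /memv_imgP[x Sx ->] ->].
have Dr : r * 'X - r = pu by rewrite Dpu mulrBr polyC1 mulr1.
rewrite dE lfunE /= linearB /= -qeval_mulX -qevalB Dr qeval_pu mulrA mulfV //.
by rewrite mul1r pS0.
Qed.

(** By rank-nullity, [qeval p] has a kernel of dimension at least the rank of
    [g] when its image lies in the kernel of [g]. *)
Lemma qeval_puncture_inj (W : vectType F) (g : 'Hom(K, W)) (p : {poly K}) :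
    coprime s N -> (size p <= \dim (limg g))%N -> (forall x, g (qeval p x) = 0) ->
  p = 0.
Proof.
move=> co_sN le_p gp0; pose f := linfun (qeval p).
apply: (@qeval_vanish p (lker f)) => // [|x]; last first.
  by rewrite memv_ker lfunE => /eqP.
have sub_fg : (limg f <= lker g)%VS.
  by apply/subvP=> _ /memv_imgP[x _ ->]; rewrite memv_ker lfunE /= gp0.
have := limg_ker_dim g fullv; have := limg_ker_dim f fullv; rewrite !capfv.
move=> Df Dg; apply: (leq_trans le_p).
rewrite -(leq_add2l (\dim (lker g))) Dg -Df addnC leq_add2r.
exact: dimvS.
Qed.

Lemma qeval_puncture_eq (W : vectType F) (g : 'Hom(K, W)) (p r : {poly K}) n :
    coprime s N -> (n <= \dim (limg g))%N -> (size p <= n)%N ->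
    (size r <= n)%N -> (forall x, g (qeval p x) = g (qeval r x)) ->
  p = r.
Proof.
move=> co_sN le_n le_p le_r gpr; apply/eqP; rewrite -subr_eq0; apply/eqP.
apply: (@qeval_puncture_inj _ g) => // [|x]; last first.
  by rewrite qevalB linearB /= gpr subrr.
apply: leq_trans (size_polyD _ _) _; rewrite size_polyN geq_max.
by rewrite !(leq_trans _ le_n).
Qed.

End LinearizedPolynomials.

(** * The left idealiser of a punctured twisted Gabidulin code *)

Section TwistedGabidulin.

Variables (F : finFieldType) (K : fieldExtType F) (s : nat).
Local Notation q := #|F|.
Local Notation N := (\dim {:K}).
Hypothesis co_sN : coprime s N.

Definition twisted_poly (k c : nat) (eta : K) (a : nat -> K) : {poly K} :=
  \poly_(i < k) a i + (a 0%N ^+ (q ^ c) * eta) *: 'X^k.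

Lemma qeval_twisted k c eta a x :
  qeval s (twisted_poly k c eta a) x = tgab_fun k s c eta a x.
Proof. by rewrite qevalD qeval_poly qevalZXn. Qed.

Lemma size_twisted k c eta a : (size (twisted_poly k c eta a) <= k.+1)%N.
Proof.
rewrite (leq_trans (size_polyD _ _)) // geq_max ltnW ?ltnS ?size_poly //=.
by rewrite (leq_trans (size_scale_leq _ _)) ?size_polyXn.
Qed.

Lemma coef_twisted k c eta a j :
  (twisted_poly k c eta a)`_j =
    if (j < k)%N then a j else if j == k then a 0%N ^+ (q ^ c) * eta else 0.
Proof.
rewrite coefD coef_poly coefZ coefXn.
by case: ltngtP; rewrite ?mulr0 ?mulr1 ?addr0 ?add0r.
Qed.

(** The images under [phi] of k codewords determine the same map [phi \o g],
    and comparing them coefficient by coefficient leaves only [b x]. The two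
    conditions on the rank of [g] are what this comparison needs: it involves
    k+2 consecutive coefficients if k > 2, and 5 of them if k = 2. *)
Lemma twisted_left_idealiser (W : vectType F) (g : 'Hom(K, W)) (phi : 'End(W))
    (k c : nat) (eta : K) :
    (1 < k)%N -> (k.+2 <= \dim (limg g))%N ->
    (k = 2%N -> 5 <= \dim (limg g))%N ->
    (forall a, exists a', forall x,
       phi (g (tgab_fun k s c eta a x)) = g (tgab_fun k s c eta a' x)) ->
  exists b, forall x, phi (g x) = g (b * x).
Proof.
move=> k_gt1 le_k2 le_5 stab.
(* [rep i p] says that p is the sigma-polynomial of a codeword whose image under
   g is that of the monomial x^(sigma^i) under phi o g; k.+1 coefficients with a
   relation between the extreme ones is the shape of a codeword. *)
pose rep i (p : {poly K}) := [/\ (size p <= k.+1)%N,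
  p`_k = p`_0 ^+ (q ^ c) * eta &
  forall x, phi (g (x ^+ (q ^ (s * i)))) = g (qeval s p x)].
have ex_rep i : (0 < i < k)%N -> exists p, rep i p.
  case/andP=> i_gt0 lt_ik; have [a Da] := stab (fun j => (j == i)%:R).
  exists (twisted_poly k c eta a); split=> [||x]; first exact: size_twisted.
    by rewrite !coef_twisted ltnn eqxx ltnW.
  rewrite qeval_twisted -Da; congr (phi (g _)).
  rewrite -qeval_twisted -qeval_Xn; congr (qeval s _ x).
  apply/polyP=> j; rewrite coefXn coef_twisted (ltn_eqF i_gt0) frob0 mul0r.
  have [-> | ne_ji] := eqVneq j i; first by rewrite lt_ik.
  by case: ifP => // _; case: ifP.
have rep_step i p r : rep i p -> rep i.+1 r -> r = p * 'X.
  case=> szp _ Tp [szr _ Tr].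
  apply: (qeval_puncture_eq co_sN le_k2) => [||x].
  - by rewrite ltnW.
  - by rewrite (leq_trans (size_polyMleq _ _)) // size_polyX addn2 /= ltnS.
  by rewrite -Tr qeval_mulX -Tp -exprM -expnD mulnS.
(* All the codewords of the monomials are shifts of a single one, p. The last of
   these shifts, by k - 2, still has sigma-degree at most k, so p has at most the
   three coefficients p_0, p_1, p_2; and p_2 is tied to the constant coefficient
   of this last shift, which is 0 unless the shift is trivial. *)
have [p rep_p] : exists p, rep 1%N p by apply: ex_rep.
have rep_p_Xn i : (i.+1 < k)%N -> rep i.+1 (p * 'X^i).
  elim: i => [|i IHi] lt_ik; first by rewrite mulr1.
  have [r rep_r] := ex_rep i.+2 lt_ik.
  by rewrite exprSr mulrA -(rep_step _ _ _ (IHi (ltnW lt_ik)) rep_r).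
have [|szpX pX2 _] := rep_p_Xn (k - 2)%N; first by lia.
have [_ _ Tp] := rep_p.
have szp : (size p <= 3)%N.
  have [-> | nz_p] := eqVneq p 0; first by rewrite size_poly0.
  by move: szpX; rewrite size_Mmonic ?monicXn // size_polyXn; lia.
have {}pX2 : p`_2 = if k == 2%N then p`_0 ^+ (q ^ c) * eta else 0.
  have -> : p`_2 = (p * 'X^(k - 2))`_k.
    by rewrite coefMXn ltnNge leq_subr subKn.
  rewrite pX2 coefMXn subn_gt0; case: eqP => [-> // | ne_k2].
  by rewrite ifT ?frob0 ?mul0r //; lia.
have Dp : p = p`_0 *: 'X^0 + p`_1 *: 'X^1 + p`_2 *: 'X^2.
  apply/polyP=> j; rewrite !coefD !coefZ !coefXn.
  case: j => [|[|[|j]]]; rewrite ?mulr0 ?mulr1 ?addr0 ?add0r //=.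
  by rewrite nth_default // (leq_trans szp).
(* It remains to use the codeword x + eta x^(sigma^k). Precomposing with sigma
   turns it into the sum of x^sigma and y^sigma, y = zeta x^(sigma^k), on which
   phi o g is already known through p. *)
have [a0 Da0] := stab (fun j => (j == 0%N)%:R).
set r := twisted_poly k c eta a0.
have [zeta Dzeta] := frob_surj eta s.
pose p' := (p`_0 * zeta) *: 'X^k + (p`_1 * zeta ^+ (q ^ s)) *: 'X^(k.+1)
  + (p`_2 * zeta ^+ (q ^ (s * 2))) *: 'X^(k.+2).
have Dpp' : p + p' = r * 'X.
  pose n := if p`_2 == 0 then k.+2 else 5.
  have le_n : (n <= \dim (limg g))%N.
    rewrite /n; case: ifP => // /eqP; rewrite pX2; case: eqP => // k2 _.
    exact: le_5.
  have le_k2n : (k.+2 <= n)%N.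
    by rewrite /n; case: ifP => // /eqP; rewrite pX2; case: eqP => // ->.
  apply: (qeval_puncture_eq co_sN le_n) => [||x].
  - have szZXn b i : (i < n)%N -> (size (b *: 'X^i : {poly K}) <= n)%N.
      by move=> lt_in; rewrite (leq_trans (size_scale_leq _ _)) ?size_polyXn.
    rewrite (leq_trans (size_polyD _ _)) // geq_max (leq_trans szp); last by lia.
    rewrite /p' (leq_trans (size_polyD _ _)) // geq_max; apply/andP; split.
      by rewrite (leq_trans (size_polyD _ _)) // geq_max !szZXn // ltnW.
    have [p2_0 | nz_p2] := eqVneq p`_2 0.
      by rewrite p2_0 mul0r scale0r size_poly0.
    rewrite szZXn // /n (negPf nz_p2).
    by move: nz_p2; rewrite pX2; case: (k =P 2%N) => [-> | _] //; rewrite eqxx.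
  - rewrite (leq_trans (size_polyMleq _ _)) // size_polyX addn2 /=.
    by rewrite (leq_trans _ le_k2n) // ltnS size_twisted.
  rewrite qeval_mulX qeval_twisted -Da0 qevalD linearD /=.
  have -> : qeval s p' x = qeval s p (zeta * x ^+ (q ^ (s * k))).
    rewrite [in RHS]Dp !qevalD !qevalZXn; congr (_ + _ + _).
    - by rewrite muln0 expr1 mulrA.
    - by rewrite exprMn -exprM -expnD muln1 addnC -mulnS mulrA.
    by rewrite exprMn -exprM -expnD mulrA -mulnDr addn2.
  rewrite -!Tp -!linearD /=; congr (phi (g _)).
  rewrite -qeval_twisted /twisted_poly eqxx expr1n mul1r qevalD qevalZXn.
  rewrite muln1 exprMn Dzeta -!exprM [in RHS](mulnC (q ^ s)%N); congr (_ + _).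
  rewrite qeval_poly /gab_fun (bigD1 (Ordinal (ltnW k_gt1))) //= big1 => [|i].
    by rewrite addr0 mul1r muln0 expr1.
  by rewrite -val_eqE /= => /negPf->; rewrite mul0r.
(* The right-hand side of Dpp' has no constant term, and p' starts in degree
   k > 0. *)
have p0 : p`_0 = 0.
  have /(congr1 (fun t : {poly K} => t`_0)) := Dpp'.
  rewrite coefMX !coefD !coefZ !coefXn [0%N == k]ltn_eqF 1?ltnW //.
  by rewrite !mulr0 !addr0.
have p2 : p`_2 = 0.
  rewrite pX2 p0 frob0 mul0r; by case: ifP.
exists p`_1 => y; have [x <-] := frob_surj y s.
have := Tp x; rewrite muln1 => ->; congr (g _).
by rewrite [in LHS]Dp p0 p2 !scale0r add0r addr0 qevalZXn muln1.
Qed.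

End TwistedGabidulin.

(** * The dimension of a punctured twisted Gabidulin code *)

Section PuncturedDimension.

Variables (F : finFieldType) (K : fieldExtType F) (s : nat).
Local Notation q := #|F|.
Local Notation N := (\dim {:K}).
Hypothesis co_sN : coprime s N.

Lemma card_finvect (V : vectType F) : #|finvect_type V| = (q ^ \dim {:V})%N.
Proof.
rewrite -[LHS](@card_vspacef F (finvect_type V) (Vector.class (finvect_type V))).
exact: card_vspace.
Qed.

(** [Theta] stands for any faithful encoding of the maps g o f with f in the
    code, and [tau] for a parametrisation of the code without repetition by
    the set [S] of q^(Ne) elements. The code has at most q^(Nk) elements, so
    e <= k; and it has exactly q^(Nk) as long as k is less than the rank M of
    g. If k >= M, the codewords with nonzero coefficients only in degrees 1 to
    M - 1 are pairwise distinct and already more than q^(Ne), as M - 1 > e. *)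
Lemma punctured_twisted_dim (W : vectType F) (g : 'Hom(K, W)) (k c e : nat)
    (eta : K) (T : Type) (Theta : (nat -> K) -> T) (S : finType) (tau : S -> T) :
    (forall a a', Theta a = Theta a' <-> forall x,
       g (tgab_fun k s c eta a x) = g (tgab_fun k s c eta a' x)) ->
    injective tau -> (forall v, exists a, tau v = Theta a) ->
    (forall a, exists v, tau v = Theta a) ->
    #|S| = (q ^ (N * e))%N -> (e.+2 <= \dim (limg g))%N ->
  (0 < k)%N -> k = e.
Proof.
move=> ThetaP tau_inj tau_Theta Theta_tau cardS le_e2 k_gt0.
have cards l : #|{ffun 'I_l -> finvect_type K}| = (q ^ (N * l))%N.
  by rewrite card_ffun card_ord card_finvect expnM.
have le_exp i j : (q ^ (N * i) <= q ^ (N * j))%N -> (i <= j)%N.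
  by rewrite leq_exp2l ?finNzRing_gt1 // leq_pmul2l ?adim_gt0.
have inj_bound l (ext : {ffun 'I_l -> finvect_type K} -> nat -> K) :
  injective (Theta \o ext) -> (l <= e)%N.
  move=> inj_ext; apply: le_exp; rewrite -cardS -cards.
  have [f Df] := fin_all_exists (fun a => Theta_tau (ext a)).
  by apply: (@leq_card _ _ f) => a a' eq_f; apply: inj_ext; rewrite /= -!Df eq_f.
pose ext l (a : {ffun 'I_l -> finvect_type K}) i : K :=
  if insub i is Some j then a j else 0.
have extE l a (j : 'I_l) : ext l a j = a j by rewrite /ext valK.
have ext_default l a i : (l <= i)%N -> ext l a i = 0.
  by move=> le_li; rewrite /ext insubN // -leqNgt.
have le_ek : (e <= k)%N.
  apply: le_exp; rewrite -cardS -cards.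
  have /fin_all_exists[f Df] v : exists a : {ffun 'I_k -> finvect_type K},
    tau v = Theta (ext k a).
  - have [a ->] := tau_Theta v; exists [ffun i : 'I_k => a i].
    have eq_a i : (i < k)%N -> a i = ext k [ffun i : 'I_k => a i] i.
      by move=> lt_ik; rewrite (extE _ _ (Ordinal lt_ik)) ffunE.
    apply/ThetaP=> x; rewrite /tgab_fun /gab_fun -eq_a //; congr (g (_ + _)).
    by apply: eq_bigr => i _; rewrite -eq_a.
  by apply: (@leq_card _ _ f) => v v' eq_f; apply: tau_inj; rewrite !Df eq_f.
have Theta_inj a a' :
    (size (twisted_poly k c eta a) <= \dim (limg g))%N ->
    (size (twisted_poly k c eta a') <= \dim (limg g))%N ->
  Theta a = Theta a' -> forall i, (i < k)%N -> a i = a' i.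
- move=> sz_a sz_a' /ThetaP eq_aa' i lt_ik.
  have /(congr1 (fun p : {poly K} => p`_i)) :
      twisted_poly k c eta a = twisted_poly k c eta a'.
    apply: (qeval_puncture_eq co_sN (leqnn _) sz_a sz_a') => x.
    by rewrite !qeval_twisted.
  by rewrite !coef_twisted lt_ik.
have [lt_kM | le_Mk] := ltnP k (\dim (limg g)).
  apply/eqP; rewrite eqn_leq le_ek andbT; apply: (inj_bound k (ext k)) => a a'.
  move/Theta_inj=> eq_aa'; apply/ffunP=> i; rewrite -!extE.
  by apply: eq_aa' => //; apply: leq_trans lt_kM; apply: size_twisted.
set M := \dim (limg g) in le_e2 le_Mk Theta_inj.
pose sext (a : {ffun 'I_M.-1 -> finvect_type K}) i : K :=
  if i is j.+1 then ext M.-1 a j else 0.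
suff /(inj_bound M.-1) : injective (Theta \o sext) by lia.
have size_sext a : (size (twisted_poly k c eta (sext a)) <= M)%N.
  apply/leq_sizeP=> j le_Mj; rewrite coef_twisted /= frob0 mul0r.
  rewrite if_same; case: ifP => // _; case: j le_Mj => // j le_Mj.
  by rewrite /= ext_default //; lia.
move=> a a' /= /Theta_inj eq_aa'; apply/ffunP=> i; rewrite -!extE.
by apply: (eq_aa' _ _ i.+1); rewrite ?size_sext //; have := ltn_ord i; lia.
Qed.

End PuncturedDimension.

(** * Codes as sets of matrices *)

Section HomMatrices.

Variable F : finFieldType.

Lemma hom_mx_inj m n (W1 W2 : vectType F) (b1 : n.-tuple W1) (b2 : m.-tuple W2) :
  basis_of {:W1} b1 -> basis_of {:W2} b2 -> injective (hom_mx b1 b2).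
Proof.
move=> basis1 basis2 f f' /matrixP eq_ff'.
have eq_b1 j : f (tnth b1 j) = f' (tnth b1 j).
  rewrite (coord_basis basis2 (memvf (f _))) (coord_basis basis2 (memvf (f' _))).
  by apply: eq_bigr => i _; have := eq_ff' i j; rewrite !mxE => ->.
apply/lfunP=> x; rewrite (coord_basis basis1 (memvf x)) !linear_sum.
by apply: eq_bigr => j _; rewrite !linearZ -tnth_nth /= eq_b1.
Qed.

Lemma hom_mxB m n (W1 W2 : vectType F) (b1 : n.-tuple W1) (b2 : m.-tuple W2)
    (f f' : 'Hom(W1, W2)) :
  hom_mx b1 b2 (f - f') = hom_mx b1 b2 f - hom_mx b1 b2 f'.
Proof.
by apply/matrixP=> i j; rewrite !mxE add_lfunE opp_lfunE linearB.
Qed.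

Lemma hom_mx_comp m n p (W1 W2 W3 : vectType F) (b1 : n.-tuple W1)
    (b2 : m.-tuple W2) (b3 : p.-tuple W3) (f : 'Hom(W2, W3)) (g : 'Hom(W1, W2)) :
  basis_of {:W2} b2 ->
  hom_mx b1 b3 (f \o g)%VF = hom_mx b2 b3 f *m hom_mx b1 b2 g.
Proof.
move=> basis2; apply/matrixP=> i j; rewrite !mxE comp_lfunE.
rewrite {1}(coord_basis basis2 (memvf (g _))) !linear_sum.
by apply: eq_bigr => l _; rewrite !linearZ !mxE -tnth_nth mulrC.
Qed.

Lemma hom_mx1 n (W : vectType F) (b : n.-tuple W) :
  basis_of {:W} b -> hom_mx b b \1%VF = 1%:M.
Proof.
move=> /basis_free free_b; apply/matrixP=> i j.
by rewrite !mxE id_lfunE (tnth_nth 0) coord_free // eq_sym.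
Qed.

Lemma hom_mx_surj m n (W1 W2 : vectType F) (b1 : n.-tuple W1) (b2 : m.-tuple W2)
    (P : 'M[F]_(m, n)) :
  basis_of {:W1} b1 -> basis_of {:W2} b2 -> exists f, hom_mx b1 b2 f = P.
Proof.
move=> /basis_free free1 /basis_free free2.
pose f x := \sum_i (\sum_j P i j * coord b1 j x) *: b2`_i.
have f_lin : linear f.
  move=> a x y; rewrite /f scaler_sumr -big_split /=; apply: eq_bigr => i _.
  rewrite scalerA -scalerDl; congr (_ *: _).
  rewrite mulr_sumr -big_split /=; apply: eq_bigr => j _.
  by rewrite linearP mulrDr mulrCA.
pose fL := GRing.isLinear.Build F W1 W2 _ f f_lin.
pose f' : {linear W1 -> W2} := HB.pack f fL.
exists (linfun f'); apply/matrixP=> i j; rewrite mxE lfunE /= /f.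
rewrite coord_sum_free // (bigD1 j) //= (tnth_nth 0) coord_free // eqxx mulr1.
rewrite big1 ?addr0 // => l ne_lj.
by rewrite coord_free // eq_sym (negPf ne_lj) mulr0.
Qed.

(** Since 0 lies in [C'], the translation [Z] is minus the image of some
    codeword [A0], and the translation of [C] by [A0] is [C]. *)
Lemma additive_code_equiv m n (C C' : set 'M[F]_(m, n)) :
    (forall A B, C A -> C B -> C (A - B)) -> C' 0 -> code_equiv C C' ->
  exists (X : 'M[F]_m) (Y : 'M[F]_n) (sigma : {rmorphism F -> F}),
    [/\ X \in unitmx, Y \in unitmx &
        forall B, C' B <-> exists2 A, C A & B = X *m map_mx sigma A *m Y].
Proof.
move=> CB C'0 [X [Y [Z [sigma [uX uY _ DC']]]]]; exists X, Y, sigma.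
split=> //; pose t A := X *m map_mx sigma A *m Y.
have tB A B : t (A - B) = t A - t B by rewrite /t map_mxB mulmxBr mulmxBl.
have [A0 CA0 tA0] : exists2 A0, C A0 & t A0 + Z = 0.
  by move: C'0; rewrite DC' => -[A CA tA]; exists A.
have DZ : Z = - t A0 by apply/eqP; rewrite -addr_eq0 addrC tA0.
move=> B; rewrite DC' DZ; split=> [[A CA <-] | [A CA ->]].
  by exists (A - A0); [exact: CB | rewrite -/(t _) -/(t _) tB].
(* A + A0, written with differences only. *)
exists (A - (A0 - A0 - A0)); first by do !apply: (CB).
by rewrite -/(t _) -/(t _) !tB subrr sub0r opprK addrK.
Qed.

End HomMatrices.

(** * The right action of L on the code of G *)

Section CodeUG.

Variables (F : finFieldType) (L : fieldExtType F) (V : vectType L).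
Variables (W : vectType F) (G : 'Hom(restrict V, W)).

Lemma GammaB u v : Gamma G (u - v) = Gamma G u - Gamma G v.
Proof.
apply/lfunP=> x; rewrite add_lfunE opp_lfunE !GammaE.
by rewrite -linearB scalerBr.
Qed.

Lemma Gamma_amull v (x : L) : (Gamma G v \o amull x)%VF = Gamma G (x *: v).
Proof.
apply/lfunP=> y; rewrite comp_lfunE !GammaE lfunE /=.
by rewrite scalerA mulrC.
Qed.

(** If [Gamma G v] is zero then the whole line of v, of dimension n > h over F,
    lies in the kernel of G. *)
Lemma Gamma_inj h :
    max_line_weight (lker G) h -> (h < \dim {:L})%N -> injective (Gamma G).
Proof.
move=> [_ maxU] lt_h u v eq_uv; apply/eqP; rewrite -subr_eq0.
apply: contraLR lt_h => nz_uv; rewrite -leqNgt.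
rewrite (leq_trans _ (maxU _ nz_uv)) // /line_weight.
rewrite (capv_idPr _) ?dim_restrict_vspace ?dim_vline ?nz_uv ?mul1n //.
apply/subvP=> y; rewrite mem_restrict_vspace => /vlineP[x ->].
by rewrite memv_ker -GammaE GammaB eq_uv subrr lfunE.
Qed.

Lemma dim_restrict : \dim {:restrict V} = (\dim {:V} * \dim {:L})%N.
Proof.
rewrite -dim_restrict_vspace; congr (\dim _).
by apply/vspaceP=> v; rewrite mem_restrict_vspace memvf (@memvf _ V).
Qed.

End CodeUG.

(** * Comparing the fields *)

(** With b the remainder of m modulo N, x^(q^b) - x vanishes on the whole
    space although it has at most N coefficients; hence b = 0. *)
Lemma frob_fixed_dim (F : finFieldType) (K : fieldExtType F) m :
  (forall x : K, x ^+ (#|F| ^ m) = x) -> (\dim {:K} %| m)%N.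
Proof.
set N := \dim {:K} => fix_m; rewrite /dvdn -leqn0 leqNgt; apply/negP=> mod_gt0.
have : 'X^(m %% N) - 1 = 0 :> {poly K}.
  apply: (@qeval_vanish _ _ 1 _ fullv) => [||x _].
  - exact: coprime1n.
  - by rewrite size_XnsubC // ltn_mod adim_gt0.
  rewrite qevalB qeval_Xn mul1n qeval1; apply/eqP.
  rewrite subr_eq0 -[in X in _ == X](fix_m x).
  by rewrite [in X in _ == X](divn_eq m N) expnD exprM [(_ * N)%N]mulnC frob_dim.
by move/eqP; rewrite -size_poly_eq0 size_XnsubC.
Qed.

(** The action [phi] of L on W is intertwined by g with multiplications in K, so
    the identity b^(q^[K:F]) = b descends to L. Working with powers of a single
    x spares the construction of the embedding x |-> b. *)
Lemma embedding_dim_dvd (F : finFieldType) (L K : fieldExtType F) (W : vectType F)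
    (g : 'Hom(K, W)) (phi : L -> 'End(W)) :
    limg g = fullv -> injective phi -> phi 1 = \1%VF ->
    (forall x y, phi (x * y) = (phi x \o phi y)%VF) ->
    (forall x, exists b, forall y, phi x (g y) = g (b * y)) ->
  (\dim {:L} %| \dim {:K})%N.
Proof.
move=> img_g phi_inj phi1 phiM phi_g; apply: frob_fixed_dim => x.
have [b Db] := phi_g x.
have DbX j y : phi (x ^+ j) (g y) = g (b ^+ j * y).
  elim: j y => [|j IHj] y; first by rewrite phi1 id_lfunE mul1r.
  by rewrite exprSr phiM comp_lfunE Db IHj exprSr mulrA.
apply/phi_inj/lfunP=> w.
have /memv_imgP[y _ ->] : w \in limg g by rewrite img_g memvf.
rewrite DbX Db; congr (g (_ * y)).
by have := frob_dim b 1; rewrite muln1.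
Qed.

(** * Inequivalence *)

Section NotEquivalent.

Variables (F : finFieldType) (r n h : nat).
Hypotheses (h_gt0 : (0 < h)%N) (dvd_rn : (h.+1 %| r * n)%N).
Hypotheses (le_n : (h + 3 <= n)%N) (nh_neq : (n, h) <> (4%N, 1%N)).
Variables (L : fieldExtType F) (V : vectType L) (W : vectType F).
Variable G : 'Hom(restrict V, W).
Hypotheses (dimL : \dim {:L} = n) (dimV : \dim {:V} = r).
Hypothesis maxU : max_line_weight (lker G) h.
Variables (bL : n.-tuple L) (bW : ((r * n) %/ h.+1)%N.-tuple W).
Hypotheses (bL_basis : basis_of {:L} bL) (bW_basis : basis_of {:W} bW).

(** Both families are covered: the untwisted code is the one with [eta = 0]. *)
Lemma punctured_twisted_equiv_dvd (K K' : fieldExtType F)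
    (b : ((r * n) %/ h.+1)%N.-tuple K) (b' : n.-tuple K') (g : 'Hom(K, K'))
    (k s c : nat) (eta : K) :
    gabidulin_params K k s -> basis_of {:K} b -> basis_of {:K'} b' ->
    \dim (limg g) = n ->
    code_equiv (mx_code bL bW (code_UG G))
      (adjoint_code (mx_code b b'
         [set (g \o f)%VF | f in twisted_gabidulin_code k s c eta])%classic) ->
  (h.+1 %| r)%N.
Proof.
case=> k_gt0 _ _ co_sN b_basis b'_basis dim_g equivCD.
have rnE : (r * n = \dim {:K} * h.+1)%N.
  by rewrite (size_basis b_basis) divnK.
have n_gt0 : (0 < n)%N by lia.
pose Psi v := hom_mx bL bW (Gamma G v).
pose Theta a := hom_mx b b' (g \o linfun (tgab_fun k s c eta a))%VF.
have Psi_inj : injective Psi.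
  move=> u v /(hom_mx_inj bL_basis bW_basis); apply: (Gamma_inj maxU).
  by rewrite dimL; lia.
have ThetaP a a' : Theta a = Theta a' <-> forall x,
    g (tgab_fun k s c eta a x) = g (tgab_fun k s c eta a' x).
- split=> [/(hom_mx_inj b_basis b'_basis)/lfunP eq_aa' x | eq_aa'].
    by have := eq_aa' x; rewrite !comp_lfunE !lfunE.
  by congr hom_mx; apply/lfunP=> x; rewrite !comp_lfunE !lfunE /= eq_aa'.
have [||X [Y [sigma [uX uY DD]]]] := additive_code_equiv _ _ equivCD.
- move=> _ _ [_ [u _ <-] <-] [_ [v _ <-] <-]; exists (Gamma G (u - v)).
    by exists (u - v).
  by rewrite GammaB hom_mxB.
- exists 0; last exact: trmx0.
  exists (g \o linfun (tgab_fun k s c eta (fun=> 0)))%VF.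
    exists (linfun (tgab_fun k s c eta (fun=> 0))) => //.
    by exists (fun=> 0).
  apply/matrixP=> i j; rewrite !mxE comp_lfunE lfunE /= /tgab_fun /gab_fun.
  by rewrite frob0 !mul0r addr0 big1 ?linear0 // => l _; rewrite mul0r.
(* From here on the punctured code has two parametrisations, [tau] by V and
   [Theta] by coefficients. *)
pose tau v := (X *m map_mx sigma (Psi v) *m Y)^T.
have tau_Theta v : exists a, tau v = Theta a.
  have [_] := DD (X *m map_mx sigma (Psi v) *m Y).
  case=> [|_ [_ [_ [a _ <-] <-] <-] DB]; last by exists a; rewrite /tau -DB trmxK.
  by exists (Psi v) => //; exists (Gamma G v) => //; exists v.
have Theta_tau a : exists v, tau v = Theta a.
  have [] := DD (Theta a)^T.
  case=> [|_ [_ [v _ <-] <-] DB _]; last by exists v; rewrite /tau -DB trmxK.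
  exists (Theta a) => //; exists (g \o linfun (tgab_fun k s c eta a))%VF => //.
  by exists (linfun (tgab_fun k s c eta a)) => //; exists a.
have Dk : k = h.+1.
  have tau_inj : injective (tau : finvect_type (restrict V) -> _).
    move=> u v /trmx_inj/(can_inj (mulmxK uY))/(can_inj (mulKmx uX)).
    by move/map_mx_inj/Psi_inj.
  apply: (punctured_twisted_dim co_sN ThetaP tau_inj) => //.
    by rewrite card_finvect dim_restrict dimV dimL rnE.
  by rewrite dim_g; lia.
pose M x := hom_mx bL bL (amull x).
have M_inj : injective M.
  move=> x y /(hom_mx_inj bL_basis bL_basis)/lfunP/(_ 1).
  by rewrite !lfunE /= !mulr1.
have MM x y : M (x * y) = M x *m M y.
  rewrite -hom_mx_comp //; congr hom_mx; apply/lfunP=> z.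
  by rewrite comp_lfunE !lfunE /= mulrA.
(* The field of right multiplications of the code of G, transported by the
   equivalence and transposed: it multiplies the punctured code from the left. *)
pose P x := (invmx Y *m map_mx sigma (M x) *m Y)^T.
have PP x y : P (x * y) = P x *m P y.
  rewrite [x * y]mulrC /P MM map_mxM -trmx_mul; congr _^T.
  by rewrite !mulmxA mulmxK.
have tau_P x v : P x *m tau v = tau (x *: v).
  rewrite /tau /P /M -trmx_mul /Psi -Gamma_amull (hom_mx_comp _ _ _ _ bL_basis).
  by rewrite map_mxM !mulmxA mulmxK.
have /fin_all_exists[phi Dphi] (x : finvect_type L) :
    exists f : 'End(K'), hom_mx b' b' f = P x by apply: hom_mx_surj.
have phi_inj : injective (phi : L -> _).
  move=> x y eq_xy; apply: M_inj; have := Dphi x; rewrite eq_xy Dphi.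
  by move/trmx_inj/(can_inj (mulmxK uY))/(can_inj (mulKVmx uY))/map_mx_inj.
have phiM x y : phi (x * y) = (phi x \o phi y)%VF.
  apply: (hom_mx_inj b'_basis b'_basis).
  by rewrite (hom_mx_comp _ _ _ _ b'_basis) !Dphi PP.
have phi1 : phi 1 = \1%VF.
  apply: (hom_mx_inj b'_basis b'_basis); rewrite hom_mx1 // Dphi /P.
  have -> : M 1 = 1%:M.
    rewrite -(hom_mx1 bL_basis); congr hom_mx.
    by apply/lfunP=> y; rewrite !lfunE /= mul1r.
  by rewrite map_mx1 mulmx1 mulVmx // trmx1.
have : (\dim {:L} %| \dim {:K})%N.
  apply: (embedding_dim_dvd (g := g) _ phi_inj phi1 phiM) => [|x].
    by apply/eqP; rewrite eqEdim subvf dim_g (size_basis b'_basis) leqnn.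
  apply: (twisted_left_idealiser (k := k) (c := c) (eta := eta) co_sN);
    rewrite ?dim_g ?Dk.
  - by lia.
  - by lia.
  - move=> k2; have ne_n4 : n <> 4%N.
      by move=> n4; apply: nh_neq; congr pair; lia.
    by lia.
  rewrite -Dk => a; have [v Dv] := Theta_tau a.
  have [a' Da'] := tau_Theta (x *: v); exists a'.
  have : hom_mx b b' (phi x \o (g \o linfun (tgab_fun k s c eta a)))%VF = Theta a'.
    by rewrite (hom_mx_comp _ _ _ _ b'_basis) Dphi -/(Theta a) -Dv tau_P.
  move/(hom_mx_inj b_basis b'_basis)/lfunP=> eq_aa' y.
  by have := eq_aa' y; rewrite !comp_lfunE !lfunE.
rewrite dimL => /dvdnP[t dimK]; apply/dvdnP; exists t.
by apply/eqP; rewrite -(eqn_pmul2r n_gt0) rnE dimK mulnAC.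
Qed.

End NotEquivalent.

Theorem theorem6p3 (F : finFieldType) (r n h : nat)
    (r_gt0 : (0 < r)%N) (n_gt0 : (0 < n)%N) (h_gt0 : (0 < h)%N)
    (dvd_rn : (h.+1 %| r * n)%N) (le_n : (h + 3 <= n)%N)
    (nh_neq : (n, h) <> (4%N, 1%N))
    (L : fieldExtType F) (dimL : \dim {:L} = n)
    (V : vectType L) (dimV : \dim {:V} = r)
    (U : {vspace restrict V}) (dimU : \dim U = ((h * r * n) %/ h.+1)%N)
    (le_dimU : ((h * r * n) %/ h.+1 <= (r - 1) * n)%N)
    (maxU : max_line_weight U h)
    (W : vectType F) (dimW : \dim {:W} = ((r * n) %/ h.+1)%N)
    (G : 'Hom(restrict V, W)) (kerG : lker G = U)
    (bL : n.-tuple L) (bL_basis : basis_of {:L} bL)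
    (bW : ((r * n) %/ h.+1)%N.-tuple W) (bW_basis : basis_of {:W} bW)
    (ndvd_r : ~~ (h.+1 %| r)%N) :
  (forall D : set 'M[F]_(n, (r * n) %/ h.+1),
     is_punctured_gabidulin D ->
     ~ code_equiv (mx_code bL bW (code_UG G)) (adjoint_code D)) /\
  (forall D : set 'M[F]_(n, (r * n) %/ h.+1),
     is_punctured_twisted_gabidulin D ->
     ~ code_equiv (mx_code bL bW (code_UG G)) (adjoint_code D)).
Proof.
rewrite -kerG in maxU.
have not_equiv := punctured_twisted_equiv_dvd h_gt0 dvd_rn le_n nh_neq dimL dimV
  maxU bL_basis bW_basis.
split=> D [K [K' [b [b' [g [C [_ [b_basis b'_basis] dim_g]]]]]]].
  move=> [k [s [ks DC]]] -> equivCD; case/negP: ndvd_r.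
  apply: (not_equiv K K' b b' g k s 0%N 0) => //.
  suff <- : C = twisted_gabidulin_code k s 0 0 by [].
  rewrite DC; congr (image _ _); apply: boolp.funext => a; apply/lfunP => x.
  by rewrite !lfunE /= /tgab_fun mulr0 mul0r addr0.
move=> [k [s [c [eta [ks _ ->]]]]] -> equivCD; case/negP: ndvd_r.
exact: (not_equiv K K' b b' g k s c eta).
Qed.
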